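(* Let $G$ be an infinite commutative group, let $L$ be a linear subspace of the space of bounded real functions on $G$, and let $M:L\to\mathbb{R}$ be a linear functional. Then $M$ is a mean (with domain of medial functions exactly $L$) if and only if all of the following hold: (a) Norming: constants belong to $L$, and if $f\equiv c$ is constant then $M(f)=c$. (b) Monotonicity: if $f,g\in L$ and $f\le g$, then $M(f)\le M(g)$. (c) Closedness: if a bounded function $f:G\to\mathbb{R}$ has the property that for every $\varepsilon>0$ there are functions $\underline g,\overline g\in L$ such that $\underline g\le f\le\overline g$ and $M(\overline g)-M(\underline g)<\varepsilon$, then $f\in L$. (d) For every bounded function $f:G\to\mathbb{R}$ and every $t\in G$, the function $x\mapsto f(x+t)-f(x)$ belongs to $L$ and $M$ takes the value $0$ on it.
   Context: $G$ is an infinite commutative (discrete) group, written additively. An upper mean is a functional $\overline M$ assigning a real number to every bounded function $f:G\to\mathbb{R}$ such that: (norming) $\overline M(f)=c$ if $f\equiv c$; (monotonicity) $f\le g$ implies $\overline M(f)\le\overline M(g)$; (homogeneity) $\overline M(cf)=c\overline M(f)$ for every constant $c\ge0$; (restricted additivity) if $t\in G$ and $g(x)=f(x)+f(x+t)$, then $\overline M(g)=2\overline M(f)$; (subadditivity) $\overline M(f+g)\le\overline M(f)+\overline M(g)$. A lower mean satisfies the same requirements with subadditivity replaced by superadditivity $\underline M(f+g)\ge\underline M(f)+\underline M(g)$. The conjugate lower mean of an upper mean $\overline M$ is $\underline M(f)=-\overline M(-f)$. A functional $M$ defined on a subspace $L$ of the bounded functions is called a mean if there is an upper mean $\overline M$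 with conjugate lower mean $\underline M$ such that $\underline M(f)=\overline M(f)$ holds exactly for $f\in L$, and for $f\in L$ this common value is $M(f)$. The functions in $L$ are then called medial. *)

(* Defs.v *)
From HB Require Import structures.
From mathcomp Require Import all_boot all_order all_algebra.
From mathcomp Require Import all_classical all_reals all_analysis.

Set Implicit Arguments.
Unset Strict Implicit.
Unset Printing Implicit Defensive.

Import Order.TTheory GRing.Theory Num.Theory.
Import numFieldNormedType.Exports.

Local Open Scope classical_set_scope.
Local Open Scope ring_scope.

(* A functional on a set [L] of functions (such as [bounded_fun]) is a total
   map [(G -> R) -> R]; only its values on [L] are ever constrained or used. *)

Record upper_mean (R : realType) (G : zmodType) (Mu : (G -> R) -> R) : Prop :=
  UpperMean {
    upper_mean_norming : forall c : R, Mu (cst c) = c ;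
    upper_mean_monotone : forall f g : G -> R,
      bounded_fun f -> bounded_fun g ->
      (forall x, f x <= g x) -> Mu f <= Mu g ;
    upper_mean_homogeneous : forall (c : R) (f : G -> R),
      bounded_fun f -> 0 <= c -> Mu (c *: f) = c * Mu f ;
    upper_mean_restricted_additive : forall (t : G) (f : G -> R),
      bounded_fun f -> Mu (fun x => f x + f (x + t)) = 2 * Mu f ;
    upper_mean_subadditive : forall f g : G -> R,
      bounded_fun f -> bounded_fun g -> Mu (f + g) <= Mu f + Mu g
  }.

Definition conjugate_mean (R : realType) (G : zmodType)
    (Mu : (G -> R) -> R) : (G -> R) -> R :=
  fun f => - Mu (- f).

Definition is_mean (R : realType) (G : zmodType)
    (L : set (G -> R)) (M : (G -> R) -> R) : Prop :=
  exists Mu : (G -> R) -> R,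
    [/\ upper_mean Mu,
        forall f : G -> R, bounded_fun f ->
          (conjugate_mean Mu f = Mu f <-> L f)
      & forall f : G -> R, L f -> M f = Mu f].

Definition linear_on (R : realType) (G : zmodType)
    (L : set (G -> R)) (M : (G -> R) -> R) : Prop :=
  forall (c : R) (f g : G -> R), L f -> L g ->
    M (c *: f + g) = c * M f + M g.

Definition mean_norming (R : realType) (G : zmodType)
    (L : set (G -> R)) (M : (G -> R) -> R) : Prop :=
  forall c : R, L (cst c) /\ M (cst c) = c.

Definition mean_monotone (R : realType) (G : zmodType)
    (L : set (G -> R)) (M : (G -> R) -> R) : Prop :=
  forall f g : G -> R, L f -> L g -> (forall x, f x <= g x) -> M f <= M g.

Definition mean_closed (R : realType) (G : zmodType)
    (L : set (G -> R)) (M : (G -> R) -> R) : Prop :=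
  forall f : G -> R, bounded_fun f ->
    (forall e : R, 0 < e -> exists gl gu : G -> R,
      [/\ L gl, L gu, forall x, gl x <= f x <= gu x & M gu - M gl < e]) ->
    L f.

Definition mean_kills_differences (R : realType) (G : zmodType)
    (L : set (G -> R)) (M : (G -> R) -> R) : Prop :=
  forall (f : G -> R) (t : G), bounded_fun f ->
    L (fun x => f (x + t) - f x) /\ M (fun x => f (x + t) - f x) = 0.

(* Main.v *)
(** Given (a)-(d), extend [M] to [Mu f = inf {M g | g in L, f <= g}], which is
    sublinear because [L] is a subspace. Since
    [f + f(. + t) = 2 f + (f(. + t) - f)] and [Mu] is additive when one summand
    lies in [L], condition (d) gives restricted additivity; closedness says
    that [Mu] agrees with its conjugate only on [L].

    Conversely, that an upper mean kills differences follows by doubling the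
    shift: restricted additivity applied to [f(. + s) - f] with shift [s]
    telescopes to [Mu (f(. + 2s) - f) = 2 Mu (f(. + s) - f)], so
    [2^n |Mu (f(. + t) - f)|] stays bounded by [2 sup |f|]. *)
Require Import Defs.
From HB Require Import structures.
From mathcomp Require Import all_boot all_order all_algebra.
From mathcomp Require Import all_classical all_reals all_analysis.
From mathcomp Require Import ring lra.

Set Implicit Arguments.
Unset Strict Implicit.
Unset Printing Implicit Defensive.

Import Order.TTheory GRing.Theory Num.Theory.
Import numFieldNormedType.Exports.

Local Open Scope classical_set_scope.
Local Open Scope ring_scope.

(** * Bounded functions and their closure properties *)

Lemma bounded_fun_normP (R : realType) (T : Type) (f : T -> R) :
  bounded_fun f <-> exists B : R, forall x, `|f x| <= B.
Proof.
split=> [[B [_ fB]]|[B fB]].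
  by exists (B + 1) => x; apply: (fB (B + 1)); rewrite ?ltrDl.
exists B; split; first exact: num_real.
by move=> C BC x _ /=; exact: le_trans (fB x) (ltW BC).
Qed.

Lemma bounded_fun_add (R : realType) (T : Type) (f g : T -> R) :
  bounded_fun f -> bounded_fun g -> bounded_fun (f + g).
Proof. exact: bounded_funD. Qed.

Lemma bounded_fun_opp (R : realType) (T : Type) (f : T -> R) :
  bounded_fun f -> bounded_fun (- f).
Proof. exact: bounded_funN. Qed.

Lemma bounded_fun_scale (R : realType) (T : Type) (c : R) (f : T -> R) :
  bounded_fun f -> bounded_fun (c *: f).
Proof.
move=> /bounded_fun_normP[B fB]; apply/bounded_fun_normP.
by exists (`|c| * B) => x; rewrite fctE normrM ler_wpM2l.
Qed.

Lemma bounded_fun_cst (R : realType) (T : Type) (c : R) :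
  bounded_fun (cst c : T -> R).
Proof. by apply/bounded_fun_normP; exists `|c| => x. Qed.

Lemma bounded_fun_difference (R : realType) (G : zmodType) (f : G -> R) t :
  bounded_fun f -> bounded_fun (fun x => f (x + t) - f x).
Proof.
move=> /bounded_fun_normP[B fB]; apply/bounded_fun_normP.
by exists (B + B) => x; rewrite (le_trans (ler_normB _ _)) ?lerD.
Qed.

(** * Upper means and differences of translates *)

Section UpperMean.
Variables (R : realType) (G : zmodType) (Mu : (G -> R) -> R).
Hypothesis Mu_mean : upper_mean Mu.

Lemma upper_mean_le_bound (f : G -> R) (B : R) :
  bounded_fun f -> (forall x, f x <= B) -> Mu f <= B.
Proof.
move=> bf fB; rewrite -[leRHS](upper_mean_norming Mu_mean).
by apply: (upper_mean_monotone Mu_mean) => //; exact: bounded_fun_cst.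
Qed.

(** Subadditivity on [f + (- f) = 0]. It puts the conjugate lower mean below [Mu], so mediality of
    [f] reduces to the opposite inequality. *)
Lemma upper_mean_addN_ge0 (f : G -> R) :
  bounded_fun f -> 0 <= Mu f + Mu (- f).
Proof.
move=> bf; have := upper_mean_subadditive Mu_mean bf (bounded_fun_opp bf).
by rewrite subrr -[X in Mu X]/(cst 0) (upper_mean_norming Mu_mean).
Qed.

Lemma upper_mean_difference_doubling (f : G -> R) (t : G) (n : nat) :
  bounded_fun f ->
  Mu (fun x => f (x + t *+ 2 ^ n) - f x) =
    2 ^+ n * Mu (fun x => f (x + t) - f x).
Proof.
move=> bf; elim: n => [|n IHn]; first by rewrite expr0 mul1r.
rewrite exprS -mulrA -IHn.
rewrite -(upper_mean_restricted_additive Mu_mean (t *+ 2 ^ n));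
  last exact: bounded_fun_difference.
congr Mu; apply/funext => x.
by rewrite expnS mul2n -addnn mulrnDr addrA; ring.
Qed.

Lemma upper_mean_difference_le0 (f : G -> R) (t : G) :
  bounded_fun f -> Mu (fun x => f (x + t) - f x) <= 0.
Proof.
move=> bf; have /bounded_fun_normP[B fB] := bf.
rewrite leNgt; apply/negP => Mu_gt0.
(* The factor [2 ^+ n] is weakened to [n], so that a positive value would contradict the Archimedean
   property. *)
have Mu_le n : Mu (fun x => f (x + t) - f x) *+ n <= B + B.
  apply: (@le_trans _ _ (2 ^+ n * Mu (fun x => f (x + t) - f x))).
    rewrite -[leLHS]mulr_natl ler_pM2r // -natrX ler_nat.
    exact/ltnW/ltn_expl.
  rewrite -upper_mean_difference_doubling //.
  apply: upper_mean_le_bound; first exact: bounded_fun_difference.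
  move=> x; apply: le_trans (ler_norm _) _.
  by rewrite (le_trans (ler_normB _ _)) ?lerD.
have B0 : 0 <= B by exact: le_trans (fB 0).
have := archi_boundP (divr_ge0 (addr_ge0 B0 B0) (ltW Mu_gt0)).
rewrite ltr_pdivrMr // mulr_natl => /lt_le_trans/(_ (Mu_le _)).
by rewrite ltxx.
Qed.

(** The bound [<= 0] for [- f] bounds [Mu] of the negated difference as well. Two nonpositive
    numbers whose sum is nonnegative both vanish. *)
Lemma upper_mean_kills_differences (f : G -> R) (t : G) :
  bounded_fun f ->
  Mu (fun x => f (x + t) - f x) = 0 /\ Mu (- (fun x => f (x + t) - f x)) = 0.
Proof.
move=> bf; have bd := bounded_fun_difference t bf.
have le0 := upper_mean_difference_le0 t bf.
have := upper_mean_difference_le0 t (bounded_fun_opp bf).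
have -> : (fun x => (- f) (x + t) - (- f) x) = - (fun x => f (x + t) - f x).
  by apply/funext => x; rewrite !fctE; ring.
by have := upper_mean_addN_ge0 bd; split; lra.
Qed.

End UpperMean.

(** * Extension of [M] by infima over majorants in [L] *)

Definition upper_extension (R : realType) (G : zmodType)
    (L : set (G -> R)) (M : (G -> R) -> R) (f : G -> R) : R :=
  inf [set M g | g in [set g | L g /\ forall x, f x <= g x]].

Section UpperExtension.
Variables (R : realType) (G : zmodType).
Variables (L : set (G -> R)) (M : (G -> R) -> R).
Hypothesis L_submod : GRing.submod_closed (mem L).
Hypothesis M_linear : linear_on L M.

Lemma submod_scale_add (c : R) (f g : G -> R) : L f -> L g -> L (c *: f + g).
Proof.
case: L_submod => _ Lcl Lf Lg.
by apply/set_mem/Lcl; exact: mem_set.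
Qed.

Lemma submod0 : L 0.
Proof. by case: L_submod => /set_mem. Qed.

Lemma submodZ (c : R) (f : G -> R) : L f -> L (c *: f).
Proof.
by move=> Lf; rewrite -[_ *: _]addr0; exact: submod_scale_add submod0.
Qed.

Lemma submodD (f g : G -> R) : L f -> L g -> L (f + g).
Proof. by move=> Lf Lg; rewrite -[f]scale1r; exact: submod_scale_add. Qed.

Lemma submodN (f : G -> R) : L f -> L (- f).
Proof. by rewrite -scaleN1r; exact: submodZ. Qed.

Lemma linear_onD (f g : G -> R) : L f -> L g -> M (f + g) = M f + M g.
Proof. by move=> Lf Lg; rewrite -[f]scale1r M_linear // mul1r scale1r. Qed.

Lemma linear_on0 : M 0 = 0.
Proof.
have /esym/eqP := linear_onD submod0 submod0.
by rewrite addr0 -subr_eq0 addrK => /eqP.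
Qed.

Lemma linear_onZ (c : R) (f : G -> R) : L f -> M (c *: f) = c * M f.
Proof.
move=> Lf; rewrite -[_ *: _]addr0 M_linear ?linear_on0 ?addr0 //.
exact: submod0.
Qed.

Lemma linear_onN (f : G -> R) : L f -> M (- f) = - M f.
Proof. by move=> Lf; rewrite -scaleN1r linear_onZ // mulN1r. Qed.

Hypothesis M_norming : mean_norming L M.
Hypothesis M_monotone : mean_monotone L M.

Local Notation Mu := (upper_extension L M).

(** Keeps [inf] away from its default value. Constants do both halves: [cst B] is a majorant, and
    every majorant lies above [cst (- B)], so monotonicity bounds its [M] from below. *)
Lemma upper_extension_has_inf (f : G -> R) : bounded_fun f ->
  has_inf [set M g | g in [set g | L g /\ forall x, f x <= g x]].
Proof.
move=> /bounded_fun_normP[B fB]; split.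
  exists (M (cst B)), (cst B) => //; split; first by have [] := M_norming B.
  by move=> x; exact: le_trans (ler_norm _) (fB x).
exists (- B) => _ [g [Lg fg] <-].
have [LB <-] := M_norming (- B); apply: M_monotone => // x.
by apply: le_trans (fg x); rewrite lerNl (le_trans _ (fB x)) // -normrN ler_norm.
Qed.

Lemma upper_extension_le (f g : G -> R) :
  bounded_fun f -> L g -> (forall x, f x <= g x) -> Mu f <= M g.
Proof.
move=> bf Lg fg; apply: ge_inf; last by exists g.
by case: (upper_extension_has_inf bf).
Qed.

Lemma upper_extension_ge (f : G -> R) (a : R) : bounded_fun f ->
  (forall g, L g -> (forall x, f x <= g x) -> a <= M g) -> a <= Mu f.
Proof.
move=> bf aM; apply: lb_le_inf; first by case: (upper_extension_has_inf bf).
by move=> _ [g [Lg fg] <-]; exact: aM.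
Qed.

Lemma upper_extension_adherent (f : G -> R) (e : R) : bounded_fun f -> 0 < e ->
  exists g, [/\ L g, forall x, f x <= g x & M g < Mu f + e].
Proof.
move=> bf e0; have [_ [g [Lg fg] <-] gE] :=
  inf_adherent e0 (upper_extension_has_inf bf).
by exists g.
Qed.

Hypothesis L_bounded : L `<=` bounded_fun.

Lemma upper_extension_id (f : G -> R) : L f -> Mu f = M f.
Proof.
move=> Lf; apply/eqP; rewrite eq_le; apply/andP; split.
  exact: upper_extension_le (L_bounded Lf) Lf _.
by apply: upper_extension_ge => [|g Lg]; [exact: L_bounded|exact: M_monotone].
Qed.

Lemma upper_extension_monotone (f g : G -> R) : bounded_fun f ->
  bounded_fun g -> (forall x, f x <= g x) -> Mu f <= Mu g.
Proof.
move=> bf bg fg; apply: upper_extension_ge => // h Lh gh.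
by apply: upper_extension_le => // x; exact: le_trans (gh x).
Qed.

Lemma upper_extension_subadditive (f g : G -> R) : bounded_fun f ->
  bounded_fun g -> Mu (f + g) <= Mu f + Mu g.
Proof.
move=> bf bg; rewrite -lerBlDr.
apply: upper_extension_ge => // h Lh fh; rewrite lerBlDr -lerBlDl.
apply: upper_extension_ge => // k Lk gk; rewrite lerBlDl -linear_onD //.
apply: upper_extension_le; [exact: bounded_fun_add|exact: submodD|].
by move=> x; exact: lerD.
Qed.

(** Dividing a majorant of [c *: f] by [c] gives a majorant of [f]. *)
Lemma upper_extension_scale_le (c : R) (f : G -> R) : bounded_fun f ->
  bounded_fun (c *: f) -> 0 < c -> c * Mu f <= Mu (c *: f).
Proof.
move=> bf bcf c0; apply: upper_extension_ge => // g Lg fg.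
rewrite -ler_pdivlMl // -linear_onZ //.
apply: upper_extension_le => //; first exact: submodZ.
by move=> x; rewrite fctE ler_pdivlMl //; exact: fg.
Qed.

Lemma upper_extension_homogeneous (c : R) (f : G -> R) : bounded_fun f ->
  0 <= c -> Mu (c *: f) = c * Mu f.
Proof.
move=> bf; rewrite le_eqVlt => /predU1P[<-|c0].
  by rewrite scale0r mul0r upper_extension_id ?linear_on0 //; exact: submod0.
have bcf := bounded_fun_scale c bf.
apply/eqP; rewrite eq_le upper_extension_scale_le // andbT.
rewrite -ler_pdivrMl //.
(* The reverse inequality is the same one for the factor [c^-1] and the function [c *: f]. *)
have := @upper_extension_scale_le c^-1 (c *: f) bcf.
by rewrite scalerA mulVf ?gt_eqF // scale1r invr_gt0; exact.
Qed.

(** Subadditivity gives [<=]. For [>=] it is applied to [(f + h) + (- h)], where [- h] also lies in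
    [L] and so has value [- M h]. *)
Lemma upper_extensionD (f h : G -> R) : bounded_fun f -> L h ->
  Mu (f + h) = Mu f + M h.
Proof.
move=> bf Lh; have bh := L_bounded Lh.
apply/eqP; rewrite eq_le; apply/andP; split.
  by rewrite -(upper_extension_id Lh); exact: upper_extension_subadditive.
have := upper_extension_subadditive (bounded_fun_add bf bh) (bounded_fun_opp bh).
by rewrite addrK (upper_extension_id (submodN Lh)) linear_onN // lerBrDr.
Qed.

Hypothesis M_differences : mean_kills_differences L M.

Lemma upper_extension_upper_mean : upper_mean Mu.
Proof.
split.
- by move=> c; have [Lc Mc] := M_norming c; rewrite upper_extension_id.
- exact: upper_extension_monotone.
- by move=> c f bf; exact: upper_extension_homogeneous.
- move=> t f bf; have [Ld Md] := M_differences t bf.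
  (* The added zero is [M] of the difference [f (x + t) - f x]. *)
  rewrite -upper_extension_homogeneous // -[RHS]addr0 -Md.
  rewrite -upper_extensionD //; last exact: bounded_fun_scale.
  congr upper_extension; apply/funext => x.
  by rewrite !fctE /GRing.scale /=; ring.
- exact: upper_extension_subadditive.
Qed.

Hypothesis M_closed : mean_closed L M.

Lemma upper_extension_medial (f : G -> R) : bounded_fun f ->
  conjugate_mean Mu f = Mu f <-> L f.
Proof.
move=> bf; rewrite /conjugate_mean; split=> [fE|Lf]; last first.
  rewrite !upper_extension_id //; last exact: submodN.
  by rewrite linear_onN // opprK.
(* A near-optimal majorant [gl] of [- f] yields the minorant [- gl] of [f]. As
   [Mu f + Mu (- f) = 0], two errors of [e / 2] leave a gap [M gu + M gl < e]. *)
apply: M_closed => // e e0; have e20 : 0 < e / 2 by rewrite divr_gt0.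
have [gu [Lgu fgu Mgu]] := upper_extension_adherent bf e20.
have [gl [Lgl fgl Mgl]] := upper_extension_adherent (bounded_fun_opp bf) e20.
exists (- gl), gu; split => //; first exact: submodN.
  by move=> x; rewrite fgu andbT lerNl; exact: fgl.
by rewrite linear_onN //; lra.
Qed.

End UpperExtension.

(** * Necessity of the four conditions, and the equivalence *)

Lemma is_mean_properties (R : realType) (G : zmodType)
    (L : set (G -> R)) (M : (G -> R) -> R) :
  L `<=` bounded_fun -> is_mean L M ->
  [/\ mean_norming L M, mean_monotone L M, mean_closed L M
    & mean_kills_differences L M].
Proof.
move=> Lb [Mu [MuP medial MMu]].
(* On [L] the upper mean agrees with its conjugate, hence is odd there. *)
have MuN f : L f -> Mu (- f) = - M f.
  move=> Lf; rewrite (MMu _ Lf); have [_ /(_ Lf) <-] := medial _ (Lb _ Lf).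
  by rewrite opprK.
split.
- move=> c; have Lc : L (cst c).
    apply/(medial _ (bounded_fun_cst _ _)); rewrite /conjugate_mean.
    rewrite -[X in - Mu X]/(cst (- c)) !(upper_mean_norming MuP).
    exact: opprK.
  by split=> //; rewrite MMu // (upper_mean_norming MuP).
- move=> f g Lf Lg fg; rewrite !MMu //.
  by apply: (upper_mean_monotone MuP) => //; exact: Lb.
- move=> f bf sandwich; apply/(medial _ bf); rewrite /conjugate_mean.
  (* Mediality becomes [Mu f + Mu (- f) = 0]. The sum is nonnegative, and the sandwich bounds it by
     [M gu - M gl < e] for every [e > 0]. *)
  apply/eqP; rewrite -subr_eq0 -opprD oppr_eq0 addrC.
  rewrite eq_le upper_mean_addN_ge0 // andbT.
  apply/ler_addgt0Pr => e e0; rewrite add0r.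
  have [gl [gu [Lgl Lgu fg Me]]] := sandwich _ e0.
  have Mu_le : Mu f <= M gu.
    rewrite (MMu _ Lgu); apply: (upper_mean_monotone MuP) => //; first exact: Lb.
    by move=> x; have /andP[] := fg x.
  have MuN_le : Mu (- f) <= - M gl.
    rewrite -MuN //; apply: (upper_mean_monotone MuP).
    + exact: bounded_fun_opp.
    + exact/bounded_fun_opp/Lb.
    + by move=> x; rewrite lerN2; have /andP[] := fg x.
  lra.
- move=> f t bf; have [Mu0 MuN0] := upper_mean_kills_differences MuP t bf.
  (* [Mu] vanishes on the difference and on its negative, so the conjugate is also 0 there and the
     difference is medial. *)
  have Ld : L (fun x => f (x + t) - f x).
    apply/(medial _ (bounded_fun_difference t bf)); rewrite /conjugate_mean.
    by rewrite Mu0 MuN0 oppr0.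
  by split=> //; rewrite MMu.
Qed.

Theorem theorem3p5 (R : realType) (G : zmodType)
    (Ginf : infinite_set [set: G])
    (L : set (G -> R)) (M : (G -> R) -> R)
    (Lbounded : L `<=` bounded_fun)
    (Lsubspace : GRing.submod_closed (mem L))
    (Mlinear : linear_on L M) :
  is_mean L M <->
  [/\ mean_norming L M, mean_monotone L M, mean_closed L M
    & mean_kills_differences L M].
Proof.
split=> [|[norming monotone closedM kills]]; first exact: is_mean_properties.
exists (upper_extension L M); split.
- exact: upper_extension_upper_mean.
- by move=> f; exact: upper_extension_medial.
- by move=> f Lf; rewrite upper_extension_id.
Qed.
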